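(* If $M$ is an infinite metric space (with a fixed point $0$), then $\mathrm{Lip}_0(M)$ contains a $\Delta$-point.
   Context: For a metric space $(M,d)$ with a fixed point $0\in M$, $\mathrm{Lip}_0(M)$ is the real Banach space of all Lipschitz functions $f:M\to\mathbb{R}$ with $f(0)=0$, normed by the Lipschitz constant. For a real Banach space $X$ with closed unit ball $B_X$ and unit sphere $S_X$, a point $x\in S_X$ is a $\Delta$-point if $x\in\overline{\mathrm{conv}}\{y\in B_X:\|x-y\|\ge2-\varepsilon\}$ for every $\varepsilon>0$. *)

(* Defs.v *)
From HB Require Import structures.
From mathcomp Require Import all_boot all_order all_algebra.
From mathcomp Require Import all_classical all_reals all_analysis.
From mathcomp Require Import ring.

Set Implicit Arguments.
Unset Strict Implicit.
Unset Printing Implicit Defensive.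

Import Order.TTheory GRing.Theory Num.Theory.
Import numFieldNormedType.Exports.

Local Open Scope classical_set_scope.
Local Open Scope ring_scope.

Section Lip0.
Context {R : realType} {M : metricType R}.

Definition lip_fun (f : M -> R) : Prop :=
  exists k : R, forall x y, `|f x - f y| <= k * mdist x y.

Definition lip_slopes (f : M -> R) : set R :=
  [set `|f p.1 - f p.2| / mdist p.1 p.2 | p in [set p : M * M | p.1 != p.2]].

(* [sup set0 = 0], so the constant is 0 when [M] is a singleton. *)
Definition lip_const (f : M -> R) : R := sup (lip_slopes f).

Variable o : M.

Definition lip0_pred : {pred M -> R} := mem [set f | lip_fun f /\ f o = 0].

Record lip0 := Lip0 { lip0_val :> M -> R ; _ : lip0_val \in lip0_pred }.

HB.instance Definition _ := [isSub for lip0_val].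
HB.instance Definition _ := [Choice of lip0 by <:].

Lemma lip0_lip (f : lip0) : lip_fun f.
Proof. by case: f => f /=; rewrite inE => -[]. Qed.

Lemma lip0_at0 (f : lip0) : f o = 0.
Proof. by case: f => f /=; rewrite inE => -[]. Qed.

Lemma lip0_submod_closed : submod_closed lip0_pred.
Proof.
split; first by rewrite inE; split => //; exists 0 => x y; rewrite subrr normr0 mul0r.
move=> a u v; rewrite !inE => -[[k uk] u0] [[l vl] v0].
have E z : (a *: u + v) z = a * u z + v z by [].
split; last by rewrite E u0 v0 mulr0 addr0.
exists (`|a| * k + l) => x y; rewrite !E opprD addrACA -mulrBr.
rewrite (le_trans (ler_normD _ _))// mulrDl lerD// normrM -mulrA.
by rewrite ler_wpM2l.
Qed.

HB.instance Definition _ :=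
  GRing.isSubmodClosed.Build R (M -> R) lip0_pred lip0_submod_closed.
HB.instance Definition _ := [SubChoice_isSubLmodule of lip0 by <:].

Lemma lip0DE (f g : lip0) x : (f + g) x = f x + g x.
Proof. by []. Qed.

Lemma lip0NE (f : lip0) x : (- f) x = - f x.
Proof. by []. Qed.

Lemma lip0ZE (a : R) (f : lip0) x : (a *: f) x = a * f x.
Proof. by []. Qed.

Lemma lip_const_le (f : M -> R) (k : R) : 0 <= k ->
  (forall x y, `|f x - f y| <= k * mdist x y) -> lip_const f <= k.
Proof.
move=> k0 fk; have [S0|/set0P S0] := eqVneq (lip_slopes f) set0.
  by rewrite /lip_const S0 sup0.
apply: ge_sup => // _ [[x y] /= xy <-].
by rewrite ler_pdivrMr// mdist_gt0.
Qed.

Lemma lip_slopes_has_ubound (f : M -> R) : lip_fun f -> has_ubound (lip_slopes f).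
Proof.
move=> [k fk]; exists k => _ [[x y] /= xy <-].
by rewrite ler_pdivrMr// mdist_gt0.
Qed.

Lemma lip_constP (f : M -> R) x y : lip_fun f ->
  `|f x - f y| <= lip_const f * mdist x y.
Proof.
move=> fL; have [->|xy] := eqVneq x y; first by rewrite mdistxx subrr normr0 mulr0.
rewrite -ler_pdivrMr ?mdist_gt0//; apply: ub_le_sup.
  exact: lip_slopes_has_ubound.
by exists (x, y).
Qed.

Lemma lip_const_ge0 (f : M -> R) : 0 <= lip_const f.
Proof.
have [[S0 Sub]|/sup_out S0] := pselect (has_sup (lip_slopes f)); last first.
  by rewrite /lip_const S0.
have [r Sr] := S0; apply: le_trans (ub_le_sup Sub Sr).
by have [p _ <-] := Sr; rewrite divr_ge0 ?mdist_ge0.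
Qed.

Let lip_constD (f g : lip0) :
  lip_const (f + g : lip0) <= lip_const f + lip_const g.
Proof.
apply: lip_const_le; first by rewrite addr_ge0 ?lip_const_ge0.
move=> x y; rewrite !lip0DE opprD addrACA (le_trans (ler_normD _ _))// mulrDl.
by rewrite lerD// lip_constP//; exact: lip0_lip.
Qed.

Let lip_constZ (a : R) (f : lip0) : lip_const (a *: f : lip0) = `|a| * lip_const f.
Proof.
have le_ b (g : lip0) : lip_const (b *: g : lip0) <= `|b| * lip_const g.
  apply: lip_const_le; first by rewrite mulr_ge0 ?lip_const_ge0.
  move=> x y; rewrite !lip0ZE -mulrBr normrM -mulrA ler_wpM2l//.
  by rewrite lip_constP//; exact: lip0_lip.
apply/eqP; rewrite eq_le le_ /=; have [->|a0] := eqVneq a 0.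
  by rewrite normr0 mul0r lip_const_ge0.
have := le_ a^-1 (a *: f); rewrite scalerA mulVf// scale1r normfV.
by rewrite mulrC ler_pdivlMr ?normr_gt0// mulrC.
Qed.

Let lip_const_eq0 (f : lip0) : lip_const f = 0 -> f = 0.
Proof.
move=> f0; apply/val_inj/funext => x /=.
have := lip_constP x o (lip0_lip f).
by rewrite f0 mul0r lip0_at0 subr0 normr_le0 => /eqP.
Qed.

HB.instance Definition _ :=
  @Lmodule_isNormed.Build R lip0 (fun f => lip_const f)
    lip_constD lip_constZ lip_const_eq0.

Lemma lip0_normE (f : lip0) : `|f| = lip_const f.
Proof. by []. Qed.

Let lip0_complete (F : set_system lip0) :
  ProperFilter F -> cauchy F -> cvg F.
Proof.
move=> FF /cauchy_ballP Fc.
have dist_le (f g : lip0) x y :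
    `|(f x - f y) - (g x - g y)| <= `|f - g| * mdist x y.
  have -> : f x - f y - (g x - g y) = (f - g) x - (f - g) y.
    by rewrite !lip0DE !lip0NE; ring.
  by apply: lip_constP; exact: lip0_lip.
have ev_cvg x : cvg ((fun f : lip0 => f x) @ F).
  apply: cauchy_cvg; apply/cauchy_ballP => e e0.
  have d0 : 0 < mdist x o + 1 by rewrite ltr_wpDl// mdist_ge0.
  have [[A B] /= [FA FB] AB] := Fc (e / (mdist x o + 1)) (divr_gt0 e0 d0).
  exists ((fun f : lip0 => f x) @` A, (fun f : lip0 => f x) @` B) => /=.
    by split; [apply: filterS FA | apply: filterS FB] => f ?; exists f.
  move=> [_ _] /= [[f Af <-] [g Bg <-]].
  have := AB (f, g) (conj Af Bg); rewrite -!ball_normE /ball_ /= => fg.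
  have := dist_le f g x o; rewrite !lip0_at0 !subr0 => /le_lt_trans; apply.
  have [->|xo] := eqVneq (mdist x o) 0; first by rewrite mulr0.
  rewrite (@lt_le_trans _ _ (e / (mdist x o + 1) * mdist x o))//.
    by rewrite ltr_pM2r// lt_neqAle eq_sym xo mdist_ge0.
  rewrite -mulrA ler_piMr//; first exact: ltW.
  by rewrite mulrC ler_pdivrMr// mul1r lerDl ler01.
pose l x : R := lim ((fun f : lip0 => f x) @ F).
have lE x e : 0 < e -> \forall f \near F, `|l x - (f : lip0) x| < e.
  by move=> e0; have /cvgrPdist_lt/(_ _ e0) := ev_cvg x.
have near_le e : 0 < e -> \forall f \near F, forall x y,
    `|((f : lip0) x - f y) - (l x - l y)| <= e * mdist x y.
  move=> e0; have [[A B] /= [FA FB] AB] := Fc e e0.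
  apply: filterS FA => f Af x y; apply/ler_addgt0Pl => d d0.
  have d20 : 0 < d / 2 by rewrite divr_gt0.
  have [g [Bg [gx gy]]] := filter_ex (filterI FB (filterI (lE x _ d20) (lE y _ d20))).
  have := AB (f, g) (conj Af Bg); rewrite -!ball_normE /ball_ /= => fg.
  have -> : f x - f y - (l x - l y) =
     (f x - f y - (g x - g y)) - (l x - g x) + (l y - g y).
    by rewrite !opprB; ring.
  rewrite (le_trans (ler_normD _ _))//.
  rewrite [leRHS](_ : _ = e * mdist x y + d / 2 + d / 2); last first.
    by rewrite -addrA -splitr addrC.
  rewrite lerD ?(ltW gy)// (le_trans (ler_normB _ _))// lerD ?(ltW gx)//.
  rewrite (le_trans (dist_le _ _ _ _))// ler_wpM2r ?mdist_ge0// ltW//.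
have l0 : l o = 0.
  apply/eqP; rewrite -normr_le0; apply/ler_addgt0Pl => e e0; rewrite addr0 ltW//.
  by have [f] := filter_ex (lE o e e0); rewrite lip0_at0 subr0.
have lL : lip_fun l.
  have [f fl] := filter_ex (near_le 1 ltr01); have [k fk] := lip0_lip f.
  exists (1 + k) => x y; rewrite mulrDl -[l x - l y](subKr (f x - f y)).
  by rewrite [leRHS]addrC (le_trans (ler_normB _ _))// lerD.
have lin : l \in lip0_pred by rewrite inE.
apply: (@cvgP _ F (Lip0 lin)); apply/cvgrPdist_le => e e0.
apply: filterS (near_le e e0) => f fl; rewrite distrC lip0_normE.
apply: lip_const_le; first exact: ltW.
move=> x y; have -> : (f - Lip0 lin) x - (f - Lip0 lin) y = f x - f y - (l x - l y).
  by rewrite !lip0DE !lip0NE /=; ring.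
exact: fl.
Qed.

HB.instance Definition _ := Uniform_isComplete.Build lip0 lip0_complete.

End Lip0.

Section DeltaPoint.
Context {R : realType} {X : completeNormedModType R}.

Definition convex_hull (A : set X) : set X := smallest (@convex_set R X) A.

Definition delta_point (x : X) : Prop :=
  `|x| = 1 /\
  forall e : R, 0 < e ->
    closure (convex_hull [set y : X | `|y| <= 1 /\ 2 - e <= `|x - y|]) x.

End DeltaPoint.

(* Main.v *)
(* Let x_k be points and r_k >= 0 radii with r_i + r_j <= d(x_i, x_j) for i <> j.
   The tents (r_k - d(x_k, -))^+ have disjoint supports, and every combination
   of them with coefficients bounded by c is c-Lipschitz. Suppose moreover that
   d(x_2i, x_2i+1) / (r_2i + r_2i+1) -> 1. Let f have the coefficients (-1)^k,
   and let g_i be f with the signs at 2i and 2i+1 flipped. Then |f - g_i| -> 2,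
   while a sum of n distinct f - g_i has coefficients bounded by 2, so the mean
   of n of the g_i is within 2/n of f: f is a Delta-point.

   If M is unbounded, take a_k = d(x_k, o) growing fast and
   r_k = a_k - 2 a_(k-1). If M is bounded, take a nonprincipal ultrafilter U,
   L(x) = lim_(y -> U) d(x, y) and D = lim_(x -> U) L(x), and choose x_k such
   that d(x_k, x_n) ~ L(x_k) and L(x_n) ~ D for n > k; then
   r_k ~ L(x_k) - D/2 works. This covers both the Cauchy (D = 0) and the
   nearly equilateral (D > 0) case. *)

Require Import Defs.
From mathcomp Require Import all_boot all_order all_algebra.
From mathcomp Require Import all_classical all_reals all_analysis.
From mathcomp Require Import zify ring lra.

Set Implicit Arguments.
Unset Strict Implicit.
Unset Printing Implicit Defensive.

Import Order.TTheory GRing.Theory Num.Theory.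
Import numFieldNormedType.Exports.

Local Open Scope classical_set_scope.
Local Open Scope ring_scope.

(** * Means in convex sets and a criterion for Delta-points *)

Lemma convex_set_mean (R : realFieldType) (E : lmodType R) (C : set E)
    (y : nat -> E) : @convex_set R E C -> (forall i, C (y i)) ->
  forall n, C (n.+1%:R^-1 *: \sum_(i < n.+1) y i).
Proof.
move=> Ccvx Cy; elim=> [|n IHn].
  by rewrite big_ord_recr big_ord0 /= add0r invr1 scale1r.
have p0 : 0 <= (n.+2%:R^-1 : R) by rewrite invr_ge0 ler0n.
have p1 : (n.+2%:R^-1 : R) <= 1 by rewrite invf_le1 ?ltr0n// ler1n.
have := Ccvx _ _ (Itv01 p0 p1) (mem_set (Cy n.+1)) (mem_set IHn).
rewrite inE /conv /=; congr C.
rewrite [in RHS]big_ord_recr /= scalerDr addrC; congr (_ + _).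
rewrite scalerA; congr (_ *: _).
rewrite /unstable.onem -natr1; field.
by rewrite nat1r natr1 !pnatr_eq0.
Qed.

(** The mean of [n.+1] of the [y i] lies in the convex hull and within [c / n.+1] of [x]. The norm
    of [x] is 1 because [2 - e <= |x - y 0| <= |x| + 1]. *)
Lemma delta_point_bounded_sums (R : realType) (X : completeNormedModType R)
    (x : X) (c : R) : `|x| <= 1 ->
  (forall e : R, 0 < e -> exists y : nat -> X,
    [/\ forall i, `|y i| <= 1, forall i, 2 - e <= `|x - y i| &
        forall n, `|\sum_(i < n) (x - y i)| <= c]) ->
  delta_point x.
Proof.
move=> x1 H; split.
  apply/eqP; rewrite eq_le x1 /=; apply/ler_addgt0Pl => e e0.
  have [y [/(_ 0%N) y1 /(_ 0%N) xy _]] := H e e0.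
  have := ler_normB x (y 0%N); lra.
move=> e e0; have [y [y1 xy yc]] := H e e0.
set S := [set _ | _].
move=> B /nbhs_ballP[r /= r0 rB].
have c0 : 0 <= c := le_trans (normr_ge0 _) (yc 0%N).
have [n nP] : exists n : nat, c / r < n.+1%:R.
  have /archi_boundP : 0 <= c / r by rewrite divr_ge0// ltW.
  by move=> h; exists (Num.bound (c / r)); rewrite (lt_trans h)// ltr_nat.
exists (n.+1%:R^-1 *: \sum_(i < n.+1) y i); split.
  by move=> C [Ccvx SC]; apply: (convex_set_mean Ccvx) => i; apply: SC; split.
apply: rB; rewrite -ball_normE /ball_ /=.
have -> : x - n.+1%:R^-1 *: \sum_(i < n.+1) y i =
    n.+1%:R^-1 *: \sum_(i < n.+1) (x - y i).
  rewrite sumrB scalerBr sumr_const card_ord -(scaler_nat n.+1 x) scalerA.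
  by rewrite mulVf ?pnatr_eq0// scale1r.
rewrite normrZ normfV normr_nat mulrC ltr_pdivrMr ?ltr0n//.
by rewrite (le_lt_trans (yc _))// mulrC -ltr_pdivrMr.
Qed.

(** * Lipschitz estimates for combinations of disjoint tents *)

Section Tents.
Context {R : realType} {M : metricType R}.
Variables (x : nat -> M) (r : nat -> R).

Definition tent (k : nat) (z : M) : R := Num.max 0 (r k - mdist (x k) z).

(* If no tent is positive at [z], this is the junk value 0, and [tent 0 z = 0]. *)
Definition tent_idx (z : M) : nat := xget 0%N [set k | 0 < tent k z].

(** Under [sep] below at most one tent is positive at [z], so this is the sum of all
    [s k * tent k z] without an infinite series. *)
Definition tents (s : nat -> R) (z : M) : R :=
  s (tent_idx z) * tent (tent_idx z) z.

Lemma tent_ge0 k z : 0 <= tent k z.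
Proof. by rewrite le_max lexx. Qed.

Lemma tent_gt0E k z : 0 < tent k z -> tent k z = r k - mdist (x k) z.
Proof. by rewrite lt_max ltxx /= => h; apply/max_idPr/ltW. Qed.

Lemma tent_lip k z w : `|tent k z - tent k w| <= mdist z w.
Proof.
have t1 := metric_triangle (x k) z w; have t2 := metric_triangle (x k) w z.
rewrite (metric_sym w z) in t2; have d0 := mdist_ge0 z w.
by rewrite /tent ler_norml; apply/andP; split;
  case: (leP 0 (r k - mdist (x k) z)) => ?;
  case: (leP 0 (r k - mdist (x k) w)) => ?; lra.
Qed.

Hypothesis sep : forall i j, (i < j)%N -> r i + r j <= mdist (x i) (x j).

Lemma sep_neq i j : i != j -> r i + r j <= mdist (x i) (x j).
Proof.
by rewrite neq_ltn => /orP[/sep//|/sep]; rewrite addrC metric_sym.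
Qed.

(** Follow the path from [x i] through [z] and [w] to [x j]: its length is at least [r i + r j]. *)
Lemma tent_add_le i j z w : i != j -> 0 < tent i z -> 0 < tent j w ->
  tent i z + tent j w <= mdist z w.
Proof.
move=> /sep_neq ij /tent_gt0E -> /tent_gt0E ->.
have := metric_triangle (x i) z (x j); have := metric_triangle z w (x j).
rewrite (metric_sym w); lra.
Qed.

Lemma tent_disj i j z : i != j -> 0 < tent i z -> tent j z = 0.
Proof.
move=> ij i0; apply/eqP; rewrite eq_le tent_ge0 andbT leNgt; apply/negP => j0.
by have := tent_add_le ij i0 j0; rewrite mdistxx; lra.
Qed.

Lemma tent_idxP k z : k != tent_idx z -> tent k z = 0.
Proof.
move=> kz; apply/eqP; rewrite eq_le tent_ge0 andbT leNgt; apply/negP => k0.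
have := xgetI 0%N (k0 : [set k | 0 < tent k z] k).
rewrite -/(tent_idx z) => h0; have := tent_disj kz k0.
by move=> h1; rewrite /= h1 ltxx in h0.
Qed.

Lemma tents_lip (s : nat -> R) (c : R) : (forall k, `|s k| <= c) ->
  forall z w, `|tents s z - tents s w| <= c * mdist z w.
Proof.
move=> sc z w; rewrite /tents; set k := tent_idx z; set l := tent_idx w.
have c0 : 0 <= c := le_trans (normr_ge0 _) (sc 0%N).
have [->|kl] := eqVneq k l.
  by rewrite -mulrBr normrM ler_pM// tent_lip.
have kw : tent k w = 0 by apply: tent_idxP.
have lz : tent l z = 0 by apply: tent_idxP; rewrite eq_sym.
(* For distinct indices it suffices to bound the sum of the two heights by [mdist z w]. If one
   height is 0, the other tent is 1-Lipschitz and vanishes at the opposite point. *)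
apply: (@le_trans _ _ (c * (tent k z + tent l w))).
  rewrite mulrDr (le_trans (ler_normB _ _))// !normrM.
  by rewrite lerD// ler_pM// ger0_norm// tent_ge0.
apply: ler_wpM2l => //.
have [k0|] := ltP 0 (tent k z); last first.
  move=> k0; have -> : tent k z = 0 by apply/eqP; rewrite eq_le k0 tent_ge0.
  have := tent_lip l w z; rewrite lz subr0 ger0_norm ?tent_ge0//.
  by rewrite add0r metric_sym.
have [l0|] := ltP 0 (tent l w); first exact: tent_add_le.
move=> l0; have -> : tent l w = 0 by apply/eqP; rewrite eq_le l0 tent_ge0.
by have := tent_lip k z w; rewrite kw subr0 ger0_norm ?tent_ge0// addr0.
Qed.

Lemma tents_center s k : 0 <= r k -> tents s (x k) = s k * r k.
Proof.
move=> rk; have E : tent k (x k) = r k.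
  by rewrite /tent mdistxx subr0; apply/max_idPr.
have [ki|ki] := eqVneq k (tent_idx (x k)).
  by rewrite /tents -ki E.
have rk0 : r k = 0 by rewrite -E tent_idxP.
(* A center of radius 0 may have another index selected, but by [sep] it lies outside the open
   support of that tent. *)
rewrite /tents rk0 mulr0; apply/eqP; rewrite mulf_eq0; apply/orP; right.
rewrite /tent (max_idPl _)// subr_le0.
by have := sep_neq ki; rewrite rk0 add0r metric_sym.
Qed.

End Tents.

(** * From separated centers and radii to a Delta-point *)

Section DeltaFromRadii.
Context {R : realType} {M : metricType R}.
Variables (o : M) (x : nat -> M) (r : nat -> R).
Hypothesis r_ge0 : forall k, 0 <= r k.
Hypothesis sep : forall i j, (i < j)%N -> r i + r j <= mdist (x i) (x j).

Lemma tents_lip0 (s : nat -> R) : (forall k, `|s k| <= 1) ->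
  (fun z => tents x r s z - tents x r s o) \in lip0_pred o.
Proof.
move=> s1; rewrite inE; split; last exact: subrr.
by exists 1 => z w; rewrite opprB addrA subrK; exact: tents_lip.
Qed.

Let flip (i k : nat) : R := if k./2 == i then - (-1) ^+ k else (-1) ^+ k.

Let sign1 k : `|(-1) ^+ k : R| <= 1.
Proof. by rewrite normrX normrN1 expr1n. Qed.

Let flip1 i k : `|flip i k| <= 1.
Proof. by rewrite /flip; case: ifP => _; rewrite ?normrN sign1. Qed.

(** Each [k] belongs to a single pair, so at most the summand with [n + i = k./2] is nonzero, and it
    is 2 up to sign. *)
Let flip_sum (n m k : nat) :
  `|\sum_(i < m) ((-1) ^+ k - flip (n + i) k)| <= 2.
Proof.
have -> : \sum_(i < m) ((-1) ^+ k - flip (n + i) k) =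
    (if (n <= k./2 < n + m)%N then 2 * (-1) ^+ k else 0).
  elim: m => [|m IHm]; first by rewrite big_ord0 addn0; case: ltngtP.
  rewrite big_ord_recr /= IHm /flip addnS ltnS.
  have [->|km] := eqVneq k./2 (n + m)%N.
    by rewrite leq_addr ltnn leqnn /=; ring.
  by rewrite [(k./2 <= _)%N]leq_eqVlt (negbTE km) /= subrr addr0.
case: ifP => _; last by rewrite normr0.
by rewrite normrM normrX normrN1 expr1n mulr1 normr_nat.
Qed.

Let Tf : lip0 o := Lip0 (tents_lip0 sign1).
Let Tg i : lip0 o := Lip0 (tents_lip0 (flip1 i)).

Let lip0_sumE n (F : 'I_n -> lip0 o) z :
  (\sum_(i < n) F i : lip0 o) z = \sum_(i < n) F i z.
Proof. exact: (big_morph (fun f : lip0 o => f z)). Qed.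

Lemma delta_point_of_radii :
  (forall i, x i.*2 != x i.*2.+1) ->
  (forall e, 0 < e -> exists N, forall i, (N <= i)%N ->
    mdist (x i.*2) (x i.*2.+1) <= (1 + e) * (r i.*2 + r i.*2.+1)) ->
  exists f : lip0 o, delta_point f.
Proof.
move=> xne H; exists Tf.
apply: (@delta_point_bounded_sums _ _ _ 2).
  rewrite lip0_normE; apply: lip_const_le => // z w.
  by rewrite opprB addrA subrK; exact: tents_lip.
(* With [s] the sum of the two radii of a pair and [d] the distance of its centers,
   [d <= (1 + e / 2) * s] and [s <= d] give [(2 - e) * d <= 2 * s], and [2 * s / d] is the slope of
   [f - g] there. *)
move=> e e0; have [N NP] := H _ (divr_gt0 e0 (ltr0n _ 2)).
exists (fun i => Tg (N + i)); split.
- move=> i; rewrite lip0_normE; apply: lip_const_le => // z w.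
  by rewrite opprB addrA subrK; exact: tents_lip.
- move=> i; rewrite lip0_normE; set j := (N + i)%N; set g := Tf - Tg j.
  have := NP j (leq_addr _ _); have := sep (ltnSn j.*2).
  set d := mdist _ _ => sd ds.
  have d0 : 0 < d by rewrite mdist_gt0.
  have := lip_constP (x j.*2) (x j.*2.+1) (lip0_lip g).
  have -> : g (x j.*2) - g (x j.*2.+1) = 2 * (r j.*2 + r j.*2.+1).
    rewrite /g !lip0DE !lip0NE /= !tents_center// /flip /=.
    rewrite uphalf_double half_double eqxx exprS -signr_odd odd_double expr0; ring.
  rewrite -/d => h.
  rewrite -(ler_pM2r d0); apply: le_trans h.
  apply: le_trans (ler_norm _).
  have : e / 2 * (r j.*2 + r j.*2.+1) <= e / 2 * d.
    by rewrite ler_pM2l// divr_gt0.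
  lra.
- move=> n; rewrite lip0_normE; apply: lip_const_le => // z w.
  pose u k := \sum_(i < n) ((-1) ^+ k - flip (N + i) k).
  have uE v : (\sum_(i < n) (Tf - Tg (N + i)) : lip0 o) v =
      tents x r u v - tents x r u o.
    rewrite lip0_sumE /tents !mulr_suml -sumrB; apply: eq_bigr => i _.
    by rewrite lip0DE lip0NE /= /tents; ring.
  by rewrite !uE opprB addrA subrK; apply: tents_lip => // k; exact: flip_sum.
Qed.

End DeltaFromRadii.

(** * Choosing sequences along filters; limits along ultrafilters *)

Lemma filter_sequence (T : choiceType) (o : T) (F : set_system T)
    (G : set T) (Q : nat -> T -> set T) :
  ProperFilter F -> F G -> (forall n x, G x -> F (Q n x)) ->
  exists x : nat -> T,
    (forall n, G (x n)) /\ (forall i j, (i < j)%N -> Q i (x i) (x j)).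
Proof.
move=> FF FG FQ.
(* [S n] holds the candidates compatible with all earlier choices; it decreases with [n] and stays
   in [F], hence is never empty. *)
pose S := fix S n := if n is m.+1 then S m `&` Q m (xget o (S m)) else G.
pose x n := xget o (S n).
have SS n : F (S n) /\ S n `<=` G.
  elim: n => [|n [FS SG]] /=; first by split.
  split; last by move=> y [/SG].
  apply: (filterI FS); apply: FQ; apply: SG.
  by apply: xgetPex; exact: filter_ex FS.
have xS n : S n (x n) by apply: xgetPex; exact: filter_ex (SS n).1.
have Sle i j : (i <= j)%N -> S j `<=` S i.
  elim: j => [|j IHj]; first by rewrite leqn0 => /eqP ->.
  by rewrite leq_eqVlt => /predU1P[->//|/IHj Sij] y /= [/Sij].
exists x; split=> [n|i j ij]; first exact: (SS n).2.
by have [_] := Sle _ _ ij _ (xS j).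
Qed.

Lemma cofinite_proper (T : Type) : infinite_set [set: T] ->
  ProperFilter [set A : set T | finite_set (~` A)].
Proof.
move=> Tinf; apply: Build_ProperFilter => /=; first by rewrite setC0.
split=> [|A B|A B AB] /=; first by rewrite setCT.
  by rewrite setCI finite_setU.
by apply: sub_finite_set; exact: subsetC.
Qed.

(** Compactness of [[0, B]] gives a cluster point, and an ultrafilter converges to each of its
    cluster points. *)
Lemma ultra_cvg_bounded (R : realType) (T : Type) (U : set_system T)
    (f : T -> R) (B : R) : UltraFilter U -> (forall x, 0 <= f x <= B) ->
  exists l, 0 <= l <= B /\
    forall e, 0 < e -> U [set x | `|f x - l| <= e].
Proof.
move=> UU fB.
have PF : ProperFilter (f @ U) by exact: fmap_proper_filter.
have FB : U (f @^-1` `[0, B]%classic).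
  by apply: (filterS _ filterT) => x _; rewrite /= in_itv; exact: fB.
have [l [lB lcl]] := @segment_compact R 0 B _ PF FB.
exists l; split=> [|e e0]; first by move: lB; rewrite /= in_itv.
have [//|UC] := in_ultra_setVsetC [set x | `|f x - l| <= e] UU.
have /lcl/(_ (nbhsx_ballx l e e0))[y [/= ye]] : (f @ U) [set y | ~ `|y - l| <= e].
  exact: UC.
by rewrite -ball_normE /ball_ /= distrC => /ltW.
Qed.

(** * Choice of centers and radii in unbounded and bounded spaces *)

Section Sequences.
Context {R : realType} {M : metricType R}.
Variable o : M.

Lemma delta_point_unbounded :
  (forall B : R, exists x : M, B < mdist x o) -> exists f : lip0 o, delta_point f.
Proof.
move=> unb; pose F := [set A : set M | exists B : R, forall x, B < mdist x o -> A x].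
have PF : ProperFilter F.
  apply: Build_ProperFilter_ex => [A [B BA]|].
    by have [x xB] := unb B; exists x; exact: BA.
  split.
  - by exists 0.
  - move=> P Q [B BP] [C CQ]; exists (Num.max B C) => x.
    by rewrite gt_max => /andP[/BP ? /CQ ?].
  - by move=> P Q PQ [B BP]; exists B => x /BP/PQ.
have FG : F [set x | 0 < mdist x o] by exists 0.
have [x [x0 xQ]] := @filter_sequence M o F _
  (fun n x => [set y | n.+4%:R * mdist x o <= mdist y o]) PF FG
  (fun n x _ => ex_intro _ (n.+4%:R * mdist x o) (fun y => @ltW _ _ _ _)).
pose a n := mdist (x n) o.
have a0 n : 0 < a n := x0 n.
have aS i j : (i < j)%N -> i.+4%:R * a i <= a j by exact: xQ.
have a4 i j : (i < j)%N -> 4 * a i <= a j.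
  move=> /aS; apply: le_trans; rewrite ler_pM2r// ler_nat; exact: isT.
pose r n := if n is m.+1 then a m.+1 - 2 * a m else 0.
have ra n : r n <= a n.
  by case: n => [|n] /=; [exact: ltW | have := a0 n; lra].
have tri i j : a j - a i <= mdist (x i) (x j).
  by have := metric_triangle (x j) (x i) o; rewrite (metric_sym (x j) (x i)) /a; lra.
apply: (@delta_point_of_radii _ _ o x r).
- by case=> [//|n] /=; have := a4 _ _ (ltnSn n); have := a0 n; lra.
(* [r i + r j.+1 <= a i + a j.+1 - 2 * a j <= a j.+1 - a i], as [a i <= a j]. *)
- move=> i [//|j]; rewrite ltnS => ij; have := tri i j.+1; have := ra i => /=.
  have : a i <= a j.
    by move: ij; rewrite leq_eqVlt => /predU1P[->//|/a4]; have := a0 i; lra.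
  lra.
- move=> i; rewrite -mdist_gt0; apply: lt_le_trans (tri _ _).
  by have := a4 _ _ (ltnSn i.*2); have := a0 i.*2; lra.
(* The distance exceeds the sum of the radii by at most [3 * a i.*2], while that sum is at least
   [i.*2.+2 * a i.*2]. *)
move=> e e0; exists (Num.bound (3 / e)) => i iN.
have e3 : 3 <= e * i.*2.+2%:R.
  rewrite mulrC -ler_pdivrMr//; apply: le_trans (_ : (Num.bound (3 / e))%:R <= _).
    by apply/ltW/archi_boundP; rewrite divr_ge0// ltW.
  by rewrite ler_nat; lia.
have r2 : 0 <= r i.*2.
  by case: (i.*2) => [//|n] /=; have := a4 _ _ (ltnSn n); have := a0 n; lra.
have rE : r i.*2.+1 = a i.*2.+1 - 2 * a i.*2 by [].
have rs : i.*2.+2%:R * a i.*2 <= r i.*2 + r i.*2.+1.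
  have := aS _ _ (ltnSn i.*2); rewrite rE -[i.*2.+4]addn2 natrD mulrDl; lra.
have d1 : mdist (x i.*2) (x i.*2.+1) <= a i.*2 + a i.*2.+1.
  by rewrite /a (metric_sym (x i.*2.+1)) metric_triangle.
have : e * (i.*2.+2%:R * a i.*2) <= e * (r i.*2 + r i.*2.+1) by rewrite ler_pM2l.
have : 3 * a i.*2 <= (e * i.*2.+2%:R) * a i.*2 by rewrite ler_pM2r.
rewrite -mulrA mulrDl mul1r rE; lra.
Qed.

Lemma delta_point_bounded (B : R) : infinite_set [set: M] ->
  (forall x y : M, mdist x y <= B) -> exists f : lip0 o, delta_point f.
Proof.
move=> /cofinite_proper /ultraFilterLemma[U [UU cofU]] dB.
have PU : ProperFilter U by exact: ultra_proper.
have /choice[L LP] x : exists l, 0 <= l <= B /\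
    forall e, 0 < e -> U [set y | `|mdist x y - l| <= e].
  by apply: ultra_cvg_bounded => y; rewrite mdist_ge0 dB.
have L0 x : 0 <= L x by have [/andP[]] := LP x.
have [D [/andP[D0 _] DP]] : exists l, 0 <= l <= B /\
    forall e, 0 < e -> U [set x | `|L x - l| <= e].
  by apply: ultra_cvg_bounded => x; have [] := LP x.
(* [L] has at most one zero: two zeros [p] and [q] would share a point [y] within a third of their
   distance from both. [U] contains the complement of each point. *)
have UL0 : U [set x | 0 < L x].
  have [//|UC] := in_ultra_setVsetC [set x | 0 < L x] UU.
  have [p /= /negP] := filter_ex UC; rewrite -leNgt => Lp.
  have Up : U [set x | x != p].
    apply: cofU => /=; rewrite (_ : (~` _)%classic = [set p])//.
    by apply/seteqP; split => x /=; [move=> /negP/negPn/eqP|move=> ->; rewrite eqxx].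
  have [q [/= /negP + qp]] := filter_ex (filterI UC Up); rewrite -leNgt => Lq.
  have d0 : 0 < mdist q p by rewrite mdist_gt0.
  have e0 : 0 < mdist q p / 3 by rewrite divr_gt0.
  have [y [/= yq yp]] := filter_ex (filterI ((LP q).2 _ e0) ((LP p).2 _ e0)).
  have := metric_triangle q y p; rewrite (metric_sym y).
  move: yq yp; rewrite !ler_norml; lra.
have ULD : U [set x | 3 / 4 * D <= L x].
  have [->|Dn0] := eqVneq D 0.
    by apply: (filterS _ filterT) => x _ /=; rewrite mulr0.
  have D4 : 0 < D / 4 by rewrite divr_gt0// lt_neqAle eq_sym Dn0.
  by apply: filterS (DP _ D4) => x /=; rewrite ler_norml; lra.
(* The tolerance is relative to [L x], so it remains useful when [D = 0] and the distances shrink to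
   0. *)
pose h n x := L x / n.+4.+4%:R.
have UQ n x : 0 < L x ->
    U ([set y | `|mdist x y - L x| <= h n x] `&` [set y | `|L y - D| <= h n x]).
  move=> Lx; have hx : 0 < h n x by rewrite divr_gt0.
  exact: filterI ((LP x).2 _ hx) (DP _ hx).
have [x [xG xQ]] := filter_sequence o PU (filterI UL0 ULD)
  (fun n x (Gx : ([set x | 0 < L x] `&` _) x) => UQ n x Gx.1).
pose l n := L (x n); pose k n := h n (x n).
have l0 n : 0 < l n := (xG n).1.
have lD n : 3 / 4 * D <= l n := (xG n).2.
have k0 n : 0 < k n := divr_gt0 (l0 n) (ltr0n _ n.+4.+4).
have kl n : n.+4.+4%:R * k n = l n by rewrite mulrC divfK// pnatr_eq0.
have k8 n : 8 * k n <= l n by rewrite -kl ler_pM2r// ler_nat.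
have dl i j : (i < j)%N -> l i - k i <= mdist (x i) (x j) <= l i + k i.
  by move=> /xQ[/= + _]; rewrite ler_norml -/(l i) -/(k i); lra.
have lk i j : (i < j)%N -> l j <= D + k i.
  by move=> /xQ[/= _]; rewrite ler_norml -/(l j) -/(k i); lra.
have kD i j : (i < j)%N -> D - k i <= l j.
  by move=> /xQ[/= _]; rewrite ler_norml -/(l j) -/(k i); lra.
(* The correction [2 * k n] pays for the errors in [dl] and [lk]: [r i + r j <= l i - k i].
   Nonnegativity follows from [k n <= l n / 8] and [3 / 4 * D <= l n]. *)
pose r n := l n - 2 * k n - D / 2.
apply: (@delta_point_of_radii _ _ o x r).
- by move=> n; rewrite /r; have := k8 n; have := lD n; have := l0 n; lra.
- move=> i j ij; rewrite /r; have /andP[] := dl _ _ ij; have := lk _ _ ij.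
  have := k0 j; lra.
- move=> i; rewrite -mdist_gt0; have /andP[+ _] := dl _ _ (ltnSn i.*2).
  by apply: lt_le_trans; have := k8 i.*2; have := l0 i.*2; lra.
(* The sum of the radii is at least [l m - 3 * k m - 2 * k m.+1], hence at least
   [l m - 7 * k m = m.+1 * k m] by [km]. The distance is at most [l m + k m], so the excess is at
   most [8 * k m]. *)
move=> e e0; exists (Num.bound (8 / e)) => i iN.
set m := i.*2.
have e8 : 8 <= e * m.+1%:R.
  rewrite mulrC -ler_pdivrMr//; apply: le_trans (_ : (Num.bound (8 / e))%:R <= _).
    by apply/ltW/archi_boundP; rewrite divr_ge0// ltW.
  by rewrite ler_nat; lia.
have km : k m.+1 <= 2 * k m.
  have : m.+4.+4%:R * k m.+1 <= m.+4.+4%:R * (2 * k m).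
    rewrite [leRHS]mulrCA kl (@le_trans _ _ (l m.+1))//.
      by rewrite -[leRHS]kl ler_pM2r// ler_nat.
    by have := lk _ _ (ltnSn m); have := lD m; have := k8 m; have := l0 m; lra.
  by rewrite ler_pM2l// ltr0n.
have rs : m.+1%:R * k m <= r m + r m.+1.
  have := kl m; rewrite -[m.+4.+4]/(7 + m.+1)%N natrD mulrDl /r.
  by have := kD _ _ (ltnSn m); lra.
have : e * (m.+1%:R * k m) <= e * (r m + r m.+1) by rewrite ler_pM2l.
have : 8 * k m <= (e * m.+1%:R) * k m by rewrite ler_pM2r.
have /andP[_] := dl _ _ (ltnSn m).
have := kD _ _ (ltnSn m); rewrite -mulrA mulrDl mul1r /r; lra.
Qed.

End Sequences.

Theorem theorem5p7 (R : realType) (M : metricType R) (o : M) :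
  infinite_set [set: M]%classic ->
  exists f : lip0 o, delta_point f.
Proof.
move=> Minf; have [bnd|unb] := pselect (exists B, forall x : M, mdist x o <= B).
  have [B xB] := bnd; apply: (@delta_point_bounded _ _ o (B + B)) => // x y.
  by rewrite (le_trans (metric_triangle x o y))// lerD// metric_sym.
apply: delta_point_unbounded => B; apply: contrapT => nB; apply: unb; exists B => x.
by rewrite leNgt; apply/negP => xB; apply: nB; exists x.
Qed.
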